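(* Let $x\in[0,1]$. Then $K'(x)=+\infty$ if and only if $n-3I_1(n)\to+\infty$ as $n\to\infty$, and $K'(x)=-\infty$ if and only if $n-3I_1(n)\to-\infty$ as $n\to\infty$.
   Context: Okamoto's functions. For $0<a<1$, define $F_a:[0,1]\to[0,1]$ as follows. Let $f_0(x)=x$ and, inductively for $n=0,1,2,\dots$, let $f_{n+1}$ be the unique continuous function on $[0,1]$ which is linear on each interval $[j/3^{n+1},(j+1)/3^{n+1}]$ ($j=0,\dots,3^{n+1}-1$) and satisfies, for $k=0,1,\dots,3^n-1$, $$f_{n+1}(k/3^n)=f_n(k/3^n),\qquad f_{n+1}((k+1)/3^n)=f_n((k+1)/3^n),$$ $$f_{n+1}((3k+1)/3^{n+1})=f_n(k/3^n)+a\,[f_n((k+1)/3^n)-f_n(k/3^n)],$$ $$f_{n+1}((3k+2)/3^{n+1})=f_n(k/3^n)+(1-a)\,[f_n((k+1)/3^n)-f_n(k/3^n)].$$ The sequence $(f_n)$ converges uniformly on $[0,1]$, and $F_a:=\lim_{n\to\infty}f_n$. In particular $F_{1/3}(x)=x$. For each fixed $x\in[0,1]$ the function $a\mapsto F_a(x)$ is differentiable on $(0,1)$. The function $K:[0,1]\to\mathbb{R}$ is defined by $$K(x):=\left.\frac{\partial F_a(x)}{\partial a}\right|_{a=1/3}.$$ $K'(x)=+\infty$ (resp. $-\infty$) means that $\lim_{h\to0}\frac{K(x+h)-K(x)}{h}=+\infty$ (resp. $-\infty$); at the endpoints $x=0$ and $x=1$ the limit is taken over $h$ with $x+h\in[0,1]$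 (one-sided). Ternary expansion: for $x\in[0,1]$ it is the sequence $\varepsilon_1,\varepsilon_2,\dots\in\{0,1,2\}$ with $x=\sum_{k=1}^\infty\varepsilon_k/3^k$; if $x$ has two such expansions, the one ending in all $0$'s is taken, except for $x=1$, for which the expansion with all digits $2$ is taken. For $n\in\mathbb{N}$, $I_1(n):=\#\{j\le n:\varepsilon_j=1\}$ is the number of $1$'s among the first $n$ ternary digits of $x$. *)

(* Defs.v *)
From HB Require Import structures.
From mathcomp Require Import all_boot all_order all_algebra.
From mathcomp Require Import all_classical all_reals all_analysis.

Set Implicit Arguments.
Unset Strict Implicit.
Unset Printing Implicit Defensive.

Import Order.TTheory GRing.Theory Num.Theory.
Import numFieldNormedType.Exports.

Local Open Scope classical_set_scope.
Local Open Scope ring_scope.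

(* [triadic_interp m v] is the piecewise linear interpolation of the values
   [v j] at the nodes [j / 3 ^ m]; only its values on [0, 1] matter. At [x = 1]
   we get [j = 3 ^ m], and the coefficient of [v j.+1 - v j] vanishes. *)
Definition triadic_interp (R : realType) (m : nat) (v : nat -> R) (x : R) : R :=
  let j := Num.truncn (3 ^+ m * x) in
  v j + (3 ^+ m * x - j%:R) * (v j.+1 - v j).

(* The value of f_(n+1) at [j / 3 ^ n.+1], where [f] is f_n. *)
Definition okamoto_node (R : realType) (a : R) (n : nat) (f : R -> R)
    (j : nat) : R :=
  let k := (j %/ 3)%N in
  let l := f (k%:R / 3 ^+ n) in
  let r := f (k.+1%:R / 3 ^+ n) in
  match (j %% 3)%N with
  | 0%N => l
  | 1%N => l + a * (r - l)
  | _ => l + (1 - a) * (r - l)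
  end.

Fixpoint okamoto_approx (R : realType) (a : R) (n : nat) : R -> R :=
  match n with
  | 0%N => id
  | n'.+1 =>
      triadic_interp n'.+1 (okamoto_node a n' (okamoto_approx a n'))
  end.

(* F_a; it is only meaningful for 0 < a < 1 and on [0, 1]. *)
Definition okamoto (R : realType) (a x : R) : R :=
  lim (okamoto_approx a n x @[n --> \oo]).

Definition okamoto_K (R : realType) (x : R) : R :=
  derive1 (fun a : R => okamoto a x) (1 / 3).

(* The increments [h] are those with [x + h] in [0, 1], so that the limit is
   one-sided at the endpoints. *)
Definition quotient_tends_to (R : realType) (f : R -> R) (x : R)
    (l : set_system R) : Prop :=
  (f (x + h) - f x) / h
    @[h --> within [set h : R | 0 <= x + h <= 1] (0 : R)^'] --> l.

(* Digits are indexed from 0: [e k] is the digit of [1 / 3 ^ k.+1]. *)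
Definition ternary_sum (R : realType) (x : R) (e : nat -> 'I_3) : Prop :=
  series (fun k => (e k : nat)%:R / 3 ^+ k.+1 : R) @ \oo --> x.

Definition ternary_expansion (R : realType) (x : R) (e : nat -> 'I_3) : Prop :=
  [/\ ternary_sum x e,
      x != 1 -> (exists2 e', e' <> e & ternary_sum x e') ->
        \forall k \near \oo, e k = 0%N :> nat
    & x = 1 -> forall k, e k = 2%N :> nat].

Definition count_ones (e : nat -> 'I_3) (n : nat) : nat :=
  #|[pred j : 'I_n | (e j : nat) == 1%N]|.

(* The next four lemmas check that [okamoto_approx] satisfies the conditions
   that characterize it: f_(n+1) is affine on each closed interval of the
   triadic subdivision, hence continuous, with the prescribed node values. *)
Lemma triadic_interpE (R : realType) (m : nat) (v : nat -> R) (j : nat) (x : R) :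
  j%:R <= 3 ^+ m * x <= j.+1%:R ->
  triadic_interp m v x = v j + (3 ^+ m * x - j%:R) * (v j.+1 - v j).
Proof.
rewrite /triadic_interp => /andP[jx]; rewrite le_eqVlt => /orP[/eqP ->|xj].
  by rewrite natrK subrr mul0r addr0 -natr1 addrAC subrr add0r mul1r addrC subrK.
by rewrite (@truncn_def _ _ j) // jx xj.
Qed.

Lemma okamoto_approx_node (R : realType) (a : R) (n j : nat) :
  okamoto_approx a n.+1 (j%:R / 3 ^+ n.+1) =
  okamoto_node a n (okamoto_approx a n) j.
Proof.
have xE : 3 ^+ n.+1 * (j%:R / 3 ^+ n.+1) = j%:R :> R.
  by rewrite mulrCA divff ?mulr1 // expf_neq0 // pnatr_eq0.
rewrite [LHS](@triadic_interpE _ _ _ j) xE; first by rewrite subrr mul0r addr0.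
by rewrite lexx ler_nat leqnSn.
Qed.

Lemma okamoto_approx_affine (R : realType) (a : R) (n j : nat) (x : R) :
  j%:R / 3 ^+ n <= x <= j.+1%:R / 3 ^+ n ->
  okamoto_approx a n x =
  okamoto_approx a n (j%:R / 3 ^+ n) +
  (3 ^+ n * x - j%:R) *
    (okamoto_approx a n (j.+1%:R / 3 ^+ n) - okamoto_approx a n (j%:R / 3 ^+ n)).
Proof.
case: n => [|n] jx.
  by rewrite /= expr0 !divr1 mul1r -natr1 addrAC subrr add0r mulr1 addrC subrK.
rewrite !okamoto_approx_node; apply: triadic_interpE.
by rewrite ler_pdivrMr ?exprn_gt0 // ler_pdivlMr ?exprn_gt0 // mulrC in jx.
Qed.

Lemma okamoto_approx_step (R : realType) (a : R) (n k : nat) :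
  let f := okamoto_approx a n in
  let g := okamoto_approx a n.+1 in
  let l := k%:R / 3 ^+ n in
  let r := k.+1%:R / 3 ^+ n in
  [/\ g l = f l,
      g r = f r,
      g ((3 * k + 1)%:R / 3 ^+ n.+1) = f l + a * (f r - f l)
    & g ((3 * k + 2)%:R / 3 ^+ n.+1) = f l + (1 - a) * (f r - f l)].
Proof.
have nodeE i : okamoto_approx a n.+1 (i%:R / 3 ^+ n) =
    okamoto_approx a n (i%:R / 3 ^+ n).
  have -> : i%:R / 3 ^+ n = (3 * i)%:R / 3 ^+ n.+1 :> R.
    by rewrite exprS natrM invfM mulrACA divff ?mul1r // pnatr_eq0.
  rewrite okamoto_approx_node /okamoto_node modnMr mulKn //.
  by rewrite exprS natrM invfM mulrACA divff ?mul1r // pnatr_eq0.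
move=> f g l r; split; [exact: nodeE|exact: nodeE| |].
  by rewrite /g okamoto_approx_node /okamoto_node mulnC modnMDl divnMDl // addn0.
by rewrite /g okamoto_approx_node /okamoto_node mulnC modnMDl divnMDl // addn0.
Qed.

(* Main.v *)
Require Import Defs.
From mathcomp Require Import all_boot all_order all_algebra.
From mathcomp Require Import all_classical all_reals all_analysis.
From mathcomp Require Import zify ring lra.

Import Order.TTheory GRing.Theory Num.Theory.
Import numFieldNormedType.Exports.

Local Open Scope classical_set_scope.
Local Open Scope ring_scope.

(** The function K is a Takagi-like series. Passing from f_n to f_(n+1) adds,
    on each triadic interval of level [n], a copy of the fixed function
    [(a - 1 / 3) * zigzag] scaled by the increment of f_n over that interval.
    Hence F_a is the identity plus [(a - 1 / 3)] times a series which converges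
    geometrically and depends continuously on [a] at [1 / 3]; its value at
    [1 / 3] is K ([okamoto_KE]), that is, K is the sum over [m] of
    [3 ^ - m * zigzag (fractional part of 3 ^ m * x)].

    The function [zigzag] has slope 3 on the outer thirds of [0, 1] and slope
    [- 6] on the middle third. The [n]-th partial sum of K is therefore affine
    on each triadic interval of level [n], and on the one containing [x] its
    slope is [3 * (n - 3 * I_1 n)] ([partial_K_affine],
    [triadic_slope_prefix]). The remainder is of order [3 ^ - n], and slopes on
    neighbouring intervals differ by at most 9 ([triadic_slope_adjacent]). So,
    for [h] of size between [3 ^ - n.+1] and [3 ^ - n], the difference quotient
    of K at [x] differs from [3 * (n - 3 * I_1 n)] by at most 18
    ([okamoto_K_quotient]). Every small [h] belongs to such a shell, and every
    shell but the first contains an admissible [h], so the quotient and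
    [n - 3 * I_1 n] diverge together ([shell_quotient_pinfty]). *)


(** * The correction series of Okamoto's functions *)

(** For parameter [a], one subdivision step changes the identity of [0, 1] by
    exactly [(a - 1 / 3) * zigzag]; this is the analogue of the tent function
    in Takagi's construction. *)
Definition zigzag {R : realType} (u : R) : R :=
  if u <= 1 / 3 then 3 * u else if u <= 2 / 3 then 3 - 6 * u else 3 * u - 3.

(** The increment of f_n over the triadic interval [j / 3 ^ n, j.+1 / 3 ^ n]: a
    product over the ternary digits of [j], with factor [1 - 2 * a] for each
    digit 1 and [a] for each digit 0 or 2. *)
Fixpoint okamoto_incr {R : realType} (a : R) (n j : nat) : R :=
  if n is n'.+1 then
    (if (j %% 3)%N == 1%N then 1 - 2 * a else a) * okamoto_incr a n' (j %/ 3)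
  else 1.

Definition okamoto_term {R : realType} (a x : R) (n : nat) : R :=
  let j := Num.truncn (3 ^+ n * x) in
  okamoto_incr a n j * zigzag (3 ^+ n * x - j%:R).

Lemma zigzagE (R : realType) (u : R) :
  [/\ 3 * u <= 1 -> zigzag u = 3 * u,
      1 <= 3 * u <= 2 -> zigzag u = 3 - 6 * u
    & 2 <= 3 * u -> zigzag u = 3 * u - 3].
Proof.
rewrite /zigzag; split => hu.
- by rewrite ifT //; lra.
- by case: ifPn => ?; [lra | rewrite ifT //; lra].
- by case: ifPn => ?; [lra | case: ifPn => ? //; lra].
Qed.

Lemma zigzag_norm_le1 (R : realType) (u : R) : 0 <= u <= 1 -> `|zigzag u| <= 1.
Proof.
move=> hu; rewrite ler_norml /zigzag.
case: ifPn => ?; first lra.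
by case: ifPn => ?; lra.
Qed.

(** Since [zigzag] vanishes at 0 and 1, a triadic node may be attributed to
    either of its two neighbouring intervals, and identities on a triadic
    interval extend to its right end. *)
Lemma zigzag_frac (R : realType) (y : R) (k : nat) :
  k%:R <= y <= k.+1%:R -> zigzag (y - (Num.truncn y)%:R) = zigzag (y - k%:R).
Proof.
move=> /andP[ky]; rewrite le_eqVlt => /orP[/eqP ->|yk]; last first.
  by rewrite (@truncn_def _ _ k) // ky yk.
rewrite natrK subrr -natr1 addrAC subrr add0r.
have [z0 _ _] := zigzagE R 0; have [_ _ z1] := zigzagE R 1.
by rewrite z0 ?z1; lra.
Qed.

Lemma triadic_digit (R : realType) (y : R) (k : nat) : k%:R <= y <= k.+1%:R ->
  exists2 r, (r < 3)%N & (k * 3 + r)%:R <= 3 * y <= (k * 3 + r).+1%:R.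
Proof.
rewrite -natr1 => hy.
have [h1|h1] := leP (3 * y) (3 * k%:R + 1).
  by exists 0%N => //; rewrite -natr1 !natrD natrM; lra.
have [h2|h2] := leP (3 * y) (3 * k%:R + 2).
  by exists 1%N => //; rewrite -natr1 !natrD natrM; lra.
by exists 2%N => //; rewrite -natr1 !natrD natrM; lra.
Qed.

Lemma expr3_gt0 (R : realType) (n : nat) : 0 < 3 ^+ n :> R.
Proof. by rewrite exprn_gt0. Qed.

Lemma okamoto_node_digit (R : realType) (a : R) (n k r : nat)
    (f := okamoto_approx a n) (l := f (k%:R / 3 ^+ n))
    (d := f (k.+1%:R / 3 ^+ n) - l) : (r <= 3)%N ->
  okamoto_approx a n.+1 ((k * 3 + r)%:R / 3 ^+ n.+1) =
  l + nth 0 [:: 0; a; 1 - a; 1] r * d.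
Proof.
rewrite /d /l /f.
have [_ gr g1 g2] := okamoto_approx_step a n k.
have [gl _ _ _] := okamoto_approx_step a n k.
have E i : i%:R / 3 ^+ n = (i * 3)%:R / 3 ^+ n.+1 :> R.
  by rewrite exprS natrM; field; rewrite ?expf_neq0 ?pnatr_eq0.
case: r => [|[|[|[|//]]]] _; rewrite [nth _ _ _]/=.
- by rewrite addn0 -(E k) gl mul0r addr0.
- by rewrite mulnC g1.
- by rewrite mulnC g2.
- by rewrite -[3%N]mul1n -mulnDl addn1 -(E k.+1) gr mul1r addrC subrK.
Qed.

Lemma okamoto_incrE (R : realType) (a : R) (n j : nat) :
  okamoto_approx a n (j.+1%:R / 3 ^+ n) - okamoto_approx a n (j%:R / 3 ^+ n) =
  okamoto_incr a n j.
Proof.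
elim: n j => [|n IH] j.
  by rewrite /= expr0 !divr1 -natr1 addrAC subrr add0r.
rewrite [j in LHS](divn_eq j 3) -addnS !okamoto_node_digit ?ltn_mod //; last first.
  by rewrite ltnW ?ltn_mod.
rewrite IH [okamoto_incr a n.+1 j]/=.
have : (j %% 3 < 3)%N by rewrite ltn_mod.
by case: (j %% 3)%N => [|[|[|//]]] _ /=; ring.
Qed.

(** Both f_n and f_(n+1) are affine on intervals of level [n.+1], and f_n runs
    over the interval [k] with total increment [okamoto_incr a n k], so the
    correction is a scaled copy of the first one, [(a - 1 / 3) * zigzag]. *)
Lemma okamoto_approx_succ (R : realType) (a x : R) (n k : nat) :
  k%:R <= 3 ^+ n * x <= k.+1%:R ->
  okamoto_approx a n.+1 x = okamoto_approx a n x +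
    (a - 1 / 3) * (okamoto_incr a n k * zigzag (3 ^+ n * x - k%:R)).
Proof.
move=> kx; have [r r3 rx] := triadic_digit _ _ _ kx.
have p3 := expr3_gt0 R n; have q3 := expr3_gt0 R n.+1.
rewrite (@okamoto_approx_affine _ _ n k); last first.
  by rewrite ler_pdivrMr ?ler_pdivlMr // mulrC.
rewrite (@okamoto_approx_affine _ _ n.+1 (k * 3 + r)); last first.
  by rewrite ler_pdivrMr ?ler_pdivlMr // mulrC exprS -mulrA.
rewrite -addnS !okamoto_node_digit ?(ltnW r3) // okamoto_incrE exprS -mulrA.
move: rx; set y := 3 ^+ n * x; rewrite -natr1 !natrD natrM.
set D := okamoto_incr a n k; have [z0 z1 z2] := zigzagE R (y - k%:R).
case: r r3 => [|[|[|//]]] _ /= rx.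
- by rewrite z0; [field | lra].
- by rewrite z1; [field | lra].
- by rewrite z2; [field | lra].
Qed.

Lemma truncn_frac (R : realType) (x : R) (n : nat) : 0 <= x ->
  (Num.truncn (3 ^+ n * x))%:R <= 3 ^+ n * x <= (Num.truncn (3 ^+ n * x)).+1%:R.
Proof.
move=> x0.
by have /andP[-> /ltW ->] := truncn_itv (mulr_ge0 (ltW (expr3_gt0 R n)) x0).
Qed.

(** The whole construction extends to the half-line, so the point 1 needs no
    separate treatment. *)
Lemma okamoto_approx_series (R : realType) (a x : R) (n : nat) : 0 <= x ->
  okamoto_approx a n x = x + (a - 1 / 3) * series (okamoto_term a x) n.
Proof.
move=> x0; elim: n => [|n IH].
  by rewrite seriesEnat /= big_geq // mulr0 addr0.
rewrite (okamoto_approx_succ _ _ _ _ _ (truncn_frac _ _ n x0)) IH -addrA -mulrDr.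
congr (_ + _ * _).
by rewrite !seriesEnat /= big_nat_recr.
Qed.

(** * The derivative in the parameter *)

Lemma series_geometric_tail (R : realType) (t : nat -> R) (C q : R) :
  0 < q < 1 -> (forall m, `|t m| <= C * q ^+ m) ->
  cvgn (series t) /\
  forall n, `|limn (series t) - series t n| <= C * q ^+ n / (1 - q).
Proof.
move=> /andP[q0 q1] tC.
have C0 : 0 <= C by have := tC 0%N; rewrite expr0 mulr1; apply: le_trans.
have nq1 : `|q| < 1 by rewrite gtr0_norm.
have cvt : cvgn (series t).
  apply: normed_cvg.
  apply: (@series_le_cvg _ (fun n => `|t n|) (geometric C q) _ _ _
    (is_cvg_geometric_series nq1)).
  - by move=> n; exact: normr_ge0.
  - by move=> n /=; rewrite mulr_ge0 // exprn_ge0 // ltW.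
  - exact: tC.
split=> // n.
have tailB m : (n <= m)%N -> `|series t m - series t n| <= C * q ^+ n / (1 - q).
  move=> nm; rewrite sub_series_geq //; apply: le_trans (ler_norm_sum _ _ _) _.
  apply: (@le_trans _ _ (\sum_(n <= i < m) C * q ^+ i)).
    by apply: ler_sum => i _.
  rewrite -mulr_sumr -mulrA ler_wpM2l // -(subnKC nm) geometric_partial_tail.
  by apply: geometric_le_lim => //; rewrite exprn_ge0 // ltW.
rewrite ler_norml lerBrDr lerBlDr; apply/andP; split.
  apply: limr_ge => //; exists n => // m /= /tailB; rewrite ler_norml; lra.
apply: limr_le => //; exists n => // m /= /tailB; rewrite ler_norml; lra.
Qed.

Lemma okamoto_incr_third (R : realType) (n j : nat) :
  okamoto_incr (1 / 3) n j = (1 / 3) ^+ n :> R.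
Proof.
elim: n j => [//|n IH] j /=; rewrite IH exprS.
by case: ifP => // _; congr (_ * _); lra.
Qed.

Lemma okamoto_incr_le (R : realType) (a : R) (n j : nat) :
  1 / 4 <= a <= 1 / 2 ->
  `|okamoto_incr a n j| <= (1 / 2) ^+ n.
Proof.
move=> ha; elim: n j => [|n IH] j /=; first by rewrite normr1.
rewrite normrM exprS; apply: ler_pM => //.
by rewrite ler_norml; case: ifP => _; lra.
Qed.

(** Replacing the factors one at a time, each at the cost of [2 |a - 1 / 3|],
    gives a sum of [n] products. The ratio [3 / 4], larger than the bound
    [1 / 2] on the factors, absorbs the number [n] of terms. *)
Lemma okamoto_incr_near_third (R : realType) (a : R) (n j : nat) :
  1 / 4 <= a <= 1 / 2 ->
  `|okamoto_incr a n j - okamoto_incr (1 / 3) n j|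
    <= 8 * `|a - 1 / 3| * (3 / 4) ^+ n.
Proof.
move=> ha; rewrite okamoto_incr_third; elim: n j => [|n IH] j /=.
  by rewrite subrr normr0 !mulr_ge0.
set p := if _ then _ else _; rewrite !exprS.
set w := okamoto_incr _ _ _.
have -> : p * w - 1 / 3 * (1 / 3) ^+ n =
    p * (w - (1 / 3) ^+ n) + (p - 1 / 3) * (1 / 3) ^+ n by ring.
have q3 : (1 / 3) ^+ n <= (3 / 4) ^+ n :> R.
  by apply: lerXn2r; rewrite ?nnegrE; lra.
have q0 : 0 <= (1 / 3) ^+ n :> R by rewrite exprn_ge0; lra.
have pl : `|p| <= 1 / 2 by rewrite ler_norml /p; case: ifP => _; lra.
have pd : `|p - 1 / 3| <= 2 * `|a - 1 / 3|.
  rewrite /p; case: ifP => _; last by have := normr_ge0 (a - 1 / 3); lra.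
  have -> : 1 - 2 * a - 1 / 3 = - (2 * (a - 1 / 3)) by lra.
  by rewrite normrN normrM gtr0_norm.
apply: le_trans (ler_normD _ _) _; rewrite !normrM (ger0_norm q0).
have h1 : `|p| * `|w - (1 / 3) ^+ n| <=
    1 / 2 * (8 * `|a - 1 / 3| * (3 / 4) ^+ n) by apply: ler_pM => //; exact: IH.
have h2 : `|p - 1 / 3| * (1 / 3) ^+ n <= 2 * `|a - 1 / 3| * (3 / 4) ^+ n.
  by apply: ler_pM.
by apply: le_trans (lerD h1 h2) _; lra.
Qed.

Lemma zigzag_truncn_le1 (R : realType) (x : R) (n : nat) : 0 <= x ->
  `|zigzag (3 ^+ n * x - (Num.truncn (3 ^+ n * x))%:R)| <= 1.
Proof.
move=> /(truncn_frac _ _ n); rewrite -natr1 => hx.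
by apply: zigzag_norm_le1; lra.
Qed.

Lemma okamoto_term_le (R : realType) (a x : R) (n : nat) :
  0 <= x -> 1 / 4 <= a <= 1 / 2 -> `|okamoto_term a x n| <= 1 * (1 / 2) ^+ n.
Proof.
move=> x0 ha; rewrite normrM mulrC.
by apply: ler_pM => //; [exact: zigzag_truncn_le1 | exact: okamoto_incr_le].
Qed.

(** Near [a = 1 / 3] all factors of the increments have absolute value at most
    [1 / 2], so the correction series converges geometrically. *)
Lemma okamotoE (R : realType) (a x : R) : 0 <= x -> 1 / 4 <= a <= 1 / 2 ->
  okamoto a x = x + (a - 1 / 3) * limn (series (okamoto_term a x)).
Proof.
move=> x0 ha; apply: cvg_lim => //.
have [cvt _] := @series_geometric_tail _ _ 1 (1 / 2) ltac:(lra)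
  (fun n => okamoto_term_le _ _ _ n x0 ha).
have -> : (fun n => okamoto_approx a n x) =
    (fun n => x + (a - 1 / 3) * series (okamoto_term a x) n).
  by apply/funext => n; rewrite okamoto_approx_series.
by apply: (cvgD (cvg_cst x)); exact: cvgMl_tmp.
Qed.

(** The difference quotient at [1 / 3] is the correction series itself, so
    differentiating only requires the continuity of this series in [a] at
    [1 / 3], which [okamoto_incr_near_third] provides. *)
Lemma okamoto_KE (R : realType) (x : R) : 0 <= x ->
  okamoto_K x = limn (series (okamoto_term (1 / 3) x)).
Proof.
move=> x0; apply: cvg_lim => //.
have third : 1 / 4 <= (1 / 3 : R) <= 1 / 2 by lra.
have cvt a : 1 / 4 <= a <= 1 / 2 -> cvgn (series (okamoto_term a x)).
  move=> ha.
  by have [] := @series_geometric_tail _ _ 1 (1 / 2) ltac:(lra)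
    (fun n => okamoto_term_le _ _ _ n x0 ha).
apply/cvgrPdist_le => e e0.
(* 1 / 12 keeps [h + 1 / 3] above 1 / 4; 32 is the total [8 / (1 - 3 / 4)] *)
have d0 : 0 < Num.min (1 / 12) (e / 32) :> R.
  by rewrite lt_min; apply/andP; split; lra.
near=> h.
have h0 : h != 0 by near: h; exact: nbhs_dnbhs_neq.
have : `|h| < Num.min (1 / 12) (e / 32).
  near: h; apply: nbhs_dnbhs; apply: filterS (nbhsx_ballx (0 : R) _ d0) => h.
  by rewrite /ball /= sub0r normrN.
rewrite lt_min => /andP[]; rewrite ltr_norml => hh he.
have ha : 1 / 4 <= h + 1 / 3 <= 1 / 2 by lra.
rewrite !okamotoE // subrr mul0r addr0 addrK [x + _]addrC addrK.
rewrite scalerA mulVf // scale1r -lim_seriesB; [|exact: cvt..].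
have term_diff m :
    `|(okamoto_term (1 / 3) x - okamoto_term (h + 1 / 3) x) m| <=
    8 * `|h| * (3 / 4) ^+ m.
  rewrite distrC /okamoto_term /= -mulrBl normrM -[leRHS]mulr1.
  apply: ler_pM => //; last exact: zigzag_truncn_le1.
  by rewrite -{2}[h](addrK (1 / 3)); exact: okamoto_incr_near_third.
have [_ /(_ 0%N)] := series_geometric_tail _ _ _ (3 / 4) ltac:(lra) term_diff.
rewrite seriesEnat /= big_geq // subr0 expr0 => /le_trans; apply.
have -> : 1 - 3 / 4 = 4^-1 :> R by lra.
by rewrite invrK; lra.
Unshelve. all: by end_near.
Qed.

(** * Slopes of the partial sums of K *)

Fixpoint triadic_slope (R : realType) (n j : nat) : R :=
  if n is n'.+1 then
    triadic_slope R n' (j %/ 3) + (if (j %% 3)%N == 1%N then - 6 else 3)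
  else 0.

Lemma triadic_slope_digit (R : realType) (n k r : nat) : (r < 3)%N ->
  triadic_slope R n.+1 (k * 3 + r) =
  triadic_slope R n k + (if r == 1%N then - 6 else 3).
Proof.
by move=> r3; rewrite /= modnMDl divnMDl // divn_small // addn0 modn_small.
Qed.

(** Two neighbouring intervals have addresses with a common prefix, then two
    consecutive digits, then only digits 2 on the left and only digits 0 on the
    right. Digits 0 and 2 contribute equally, so the slopes differ only through
    the pair of consecutive digits, that is by [3 - (- 6)]. *)
Lemma triadic_slope_adjacent (R : realType) (n j : nat) :
  `|triadic_slope R n j.+1 - triadic_slope R n j| <= 9.
Proof.
elim: n j => [|n IH] j; first by rewrite /= subrr normr0.
rewrite (divn_eq j 3) -addnS.
have : (j %% 3 < 3)%N by rewrite ltn_mod.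
case: (j %% 3)%N => [|[|[|//]]] _; last first.
  have -> k : (k * 3 + 3 = k.+1 * 3 + 0)%N by rewrite addn0 mulSn addnC.
  by rewrite !triadic_slope_digit //= opprD addrACA subrr addr0; exact: IH.
all: rewrite !triadic_slope_digit //= ler_norml; lra.
Qed.

Lemma triadic_parent (R : realType) (j : nat) (y : R) :
  j%:R <= 3 * y <= j.+1%:R -> (j %/ 3)%:R <= y <= (j %/ 3).+1%:R.
Proof.
rewrite {1 2}(divn_eq j 3) -!natr1 natrD natrM => hy.
have r2 : (j %% 3)%:R <= 2 :> R by rewrite ler_nat -ltnS ltn_mod.
by have := ler0n R (j %% 3); lra.
Qed.

Lemma zigzag_sub (R : realType) (k r : nat) (x y : R) : (r < 3)%N ->
  (k * 3 + r)%:R <= 3 * x <= (k * 3 + r).+1%:R ->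
  (k * 3 + r)%:R <= 3 * y <= (k * 3 + r).+1%:R ->
  zigzag (x - k%:R) - zigzag (y - k%:R) =
  (if r == 1%N then - 6 else 3) * (x - y).
Proof.
rewrite -natr1 !natrD natrM.
have [x0 x1 x2] := zigzagE R (x - k%:R); have [y0 y1 y2] := zigzagE R (y - k%:R).
case: r => [|[|[|//]]] _ /= hx hy.
- by rewrite x0 ?y0; lra.
- by rewrite x1 ?y1; lra.
- by rewrite x2 ?y2; lra.
Qed.

Lemma partial_K_affine (R : realType) (n j : nat) (x y : R) :
  j%:R <= 3 ^+ n * x <= j.+1%:R -> j%:R <= 3 ^+ n * y <= j.+1%:R ->
  series (okamoto_term (1 / 3) x) n - series (okamoto_term (1 / 3) y) n =
  triadic_slope R n j * (x - y).
Proof.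
rewrite !seriesEnat /=.
elim: n j => [|n IH] j; first by rewrite !big_geq // subrr mul0r.
rewrite exprS -!mulrA => hx hy.
have kx := triadic_parent _ _ _ hx; have ky := triadic_parent _ _ _ hy.
rewrite !big_nat_recr //= opprD addrACA (IH _ kx ky) mulrDl; congr (_ + _).
rewrite /okamoto_term !okamoto_incr_third -mulrBr.
rewrite (zigzag_frac _ _ _ kx) (zigzag_frac _ _ _ ky).
have r3 : (j %% 3 < 3)%N by rewrite ltn_mod.
rewrite (zigzag_sub _ _ _ _ _ r3) -?divn_eq // -mulrBr mulrCA.
rewrite [_ * (_ * (x - y))]mulrA.
by rewrite -exprMn mul1r mulVf ?pnatr_eq0 // expr1n mul1r.
Qed.

(** A point [y] within [3 ^ - n] of [x] lies in the interval of [x] or in a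
    neighbouring one. In the second case the segment from [x] to [y] crosses one
    node [c], beyond which the slope changes by at most 9. This covers all
    points [y] close to [x] but on the other side of a triadic node, whose
    digits may be very different from those of [x]. *)
Lemma partial_K_near (R : realType) (n j : nat) (x y : R) : 0 <= y ->
  j%:R <= 3 ^+ n * x <= j.+1%:R -> `|y - x| <= (1 / 3) ^+ n ->
  `|series (okamoto_term (1 / 3) y) n - series (okamoto_term (1 / 3) x) n -
     triadic_slope R n j * (y - x)| <= 9 * `|y - x|.
Proof.
move=> y0 hx hyx; have p3 := expr3_gt0 R n.
have pV : 3 ^+ n * (1 / 3) ^+ n = 1 :> R.
  by rewrite -exprMn mul1r mulfV ?pnatr_eq0 // expr1n.
have py0 : 0 <= 3 ^+ n * y by rewrite mulr_ge0 // ltW.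
have hpy : `|3 ^+ n * y - 3 ^+ n * x| <= 1.
  by rewrite -mulrBr normrM gtr0_norm // -[leRHS]pV ler_pM2l.
move: hpy; rewrite ler_norml => hpy.
have nodeK i : 3 ^+ n * (i%:R / 3 ^+ n) = i%:R :> R.
  by rewrite mulrC divfK // gt_eqF.
have [yl|yl] := ltP (3 ^+ n * y) j%:R.
  case: j hx yl => [|j] hx yl; first by rewrite ltNge py0 in yl.
  set c : R := j.+1%:R / 3 ^+ n.
  have cE : 3 ^+ n * c = j.+1%:R by exact: nodeK.
  have yc : y < c by rewrite -(ltr_pM2l p3) cE.
  have cx : c <= x by rewrite -(ler_pM2l p3) cE; lra.
  have e1 := @partial_K_affine R n j.+1 c x ltac:(rewrite cE -natr1; lra) hx.
  have e2 := @partial_K_affine R n j y c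
    ltac:(move: hx hpy yl; rewrite -!natr1; lra) ltac:(rewrite cE -natr1; lra).
  have -> : series (okamoto_term (1 / 3) y) n - series (okamoto_term (1 / 3) x) n
       - triadic_slope R n j.+1 * (y - x)
     = (triadic_slope R n j.+1 - triadic_slope R n j) * (c - y).
    by move: e1 e2; lra.
  rewrite normrM; apply: ler_pM => //; first exact: triadic_slope_adjacent.
  by rewrite [leRHS]distrC !ger0_norm; lra.
have [yr|yr] := leP (3 ^+ n * y) j.+1%:R.
  rewrite (@partial_K_affine R n j y x) // ?yl ?yr //.
  by rewrite subrr normr0 mulr_ge0.
set c : R := j.+1%:R / 3 ^+ n.
have cE : 3 ^+ n * c = j.+1%:R by exact: nodeK.
have yc : c < y by rewrite -(ltr_pM2l p3) cE.
have cx : x <= c by rewrite -(ler_pM2l p3) cE; lra.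
have e1 := @partial_K_affine R n j c x ltac:(rewrite cE -natr1; lra) hx.
have e2 := @partial_K_affine R n j.+1 y c
  ltac:(move: hx hpy yr; rewrite -!natr1; lra) ltac:(rewrite cE -natr1; lra).
have -> : series (okamoto_term (1 / 3) y) n - series (okamoto_term (1 / 3) x) n
     - triadic_slope R n j * (y - x)
   = (triadic_slope R n j.+1 - triadic_slope R n j) * (y - c).
  by move: e1 e2; lra.
rewrite normrM; apply: ler_pM => //; first exact: triadic_slope_adjacent.
by rewrite !ger0_norm; lra.
Qed.

Lemma okamoto_K_tail (R : realType) (n : nat) (x : R) : 0 <= x ->
  `|okamoto_K x - series (okamoto_term (1 / 3) x) n| <= 3 / 2 * (1 / 3) ^+ n.
Proof.
move=> x0; rewrite okamoto_KE //.
have tE m : `|okamoto_term (1 / 3) x m| <= 1 * (1 / 3) ^+ m.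
  rewrite /okamoto_term okamoto_incr_third normrM mulrC.
  apply: ler_pM => //; first exact: zigzag_truncn_le1.
  by rewrite ger0_norm // exprn_ge0 //; lra.
have [_ /(_ n)] := series_geometric_tail _ _ _ (1 / 3) ltac:(lra) tE.
have -> : 1 - 1 / 3 = (3 / 2)^-1 :> R by rewrite invf_div; lra.
by rewrite invrK; lra.
Qed.

(** At the scale [3 ^ - n] both errors, the change of slope and the tail of the
    series, are of the order of [h]: the tails contribute
    [2 * (3 / 2) * 3 ^ - n <= 9 |h|] and the slope contributes [9 |h|]. *)
Lemma okamoto_K_quotient (R : realType) (n j : nat) (x h : R) :
  0 <= x -> 0 <= x + h -> j%:R <= 3 ^+ n * x <= j.+1%:R ->
  (1 / 3) ^+ n.+1 <= `|h| <= (1 / 3) ^+ n ->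
  `|(okamoto_K (x + h) - okamoto_K x) / h - triadic_slope R n j| <= 18.
Proof.
move=> x0 y0 jx /andP[hl hu].
have xhx : x + h - x = h by rewrite addrAC subrr add0r.
have := @partial_K_near R n j x (x + h) y0 jx; rewrite xhx => /(_ hu).
have := okamoto_K_tail _ n _ x0; have := okamoto_K_tail _ n _ y0.
have pos : 0 < (1 / 3) ^+ n.+1 :> R by rewrite exprn_gt0 //; lra.
have h0 : h != 0 by rewrite -normr_gt0 (lt_le_trans pos).
have -> : (okamoto_K (x + h) - okamoto_K x) / h - triadic_slope R n j =
  (okamoto_K (x + h) - okamoto_K x - triadic_slope R n j * h) / h by field.
rewrite normrM normfV ler_pdivrMr ?normr_gt0 //.
move: hl; rewrite exprS !ler_norml; lra.
Qed.

(** * Ternary digits *)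

Fixpoint ternary_prefix (e : nat -> 'I_3) (n : nat) : nat :=
  if n is n'.+1 then (ternary_prefix e n' * 3 + e n')%N else 0%N.

Lemma ternary_prefix_refine (e : nat -> 'I_3) (n d : nat) :
  (ternary_prefix e n * 3 ^ d <= ternary_prefix e (n + d)
    < (ternary_prefix e n).+1 * 3 ^ d)%N.
Proof.
elim: d => [|d /andP[IHl IHu]]; first by rewrite addn0 expn0 !muln1 ltnSn leqnn.
rewrite addnS /= expnSr; have := ltn_ord (e (n + d)%N); nia.
Qed.

Lemma ternary_series_prefix (R : realType) (e : nat -> 'I_3) (n : nat) :
  series (fun k => (e k : nat)%:R / 3 ^+ k.+1 : R) n =
  (ternary_prefix e n)%:R / 3 ^+ n.
Proof.
rewrite seriesEnat /=; elim: n => [|n IH]; first by rewrite big_geq // mul0r.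
rewrite big_nat_recr //= IH natrD natrM exprS.
by field; rewrite expf_neq0 ?pnatr_eq0.
Qed.

(** The interval has to be closed: the expansion of 1, with all digits 2, puts
    1 at the right end of its interval at every level. *)
Lemma ternary_prefix_bounds (R : realType) (x : R) (e : nat -> 'I_3) (n : nat) :
  ternary_sum x e ->
  (ternary_prefix e n)%:R <= 3 ^+ n * x <= (ternary_prefix e n).+1%:R.
Proof.
rewrite /ternary_sum => xe; have p3 := expr3_gt0 R n.
have bnd m : (n <= m)%N ->
    (ternary_prefix e n)%:R / 3 ^+ n <=
      series (fun k => (e k : nat)%:R / 3 ^+ k.+1 : R) m <=
    (ternary_prefix e n).+1%:R / 3 ^+ n.
  move=> /subnKC <-; rewrite ternary_series_prefix exprD invfM.
  have /andP[rl /ltnW ru] := ternary_prefix_refine e n (m - n).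
  rewrite !mulrA; set d := (m - n)%N in rl ru *; have d3 := expr3_gt0 R d.
  rewrite (ler_pdivlMr _ _ d3) (ler_pdivrMr _ _ d3).
  rewrite mulrAC [X in _ && (_ <= X)]mulrAC.
  by rewrite !ler_pM2r ?invr_gt0 // -!natrX -!natrM !ler_nat rl ru.
rewrite mulrC -(ler_pdivrMr _ _ p3) -(ler_pdivlMr _ _ p3); apply/andP; split.
  by apply: (cvgr_to_ge xe); exists n => // m /= /bnd /andP[].
by apply: (cvgr_to_le xe); exists n => // m /= /bnd /andP[].
Qed.

Lemma count_ones_succ (e : nat -> 'I_3) (n : nat) :
  count_ones e n.+1 = (count_ones e n + (e n == 1%N :> nat))%N.
Proof.
rewrite /count_ones -!sum1_card big_mkcond big_ord_recr [in RHS]big_mkcond /=.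
by congr (_ + _)%N; rewrite inE /=; case: ifP.
Qed.

(** Each digit contributes 3 to the slope, minus 9 if it is a 1. *)
Lemma triadic_slope_prefix (R : realType) (e : nat -> 'I_3) (n : nat) :
  triadic_slope R n (ternary_prefix e n) = 3 * (n%:R - 3 * (count_ones e n)%:R).
Proof.
elim: n => [|n IH].
  by rewrite /count_ones eq_card0 => [|[]//]; rewrite /= mulr0 subrr mulr0.
rewrite triadic_slope_digit ?ltn_ord // IH count_ones_succ natrD -natr1.
by case: eqP => _ /=; ring.
Qed.

(** * From scales to limits *)

Lemma triadic_shell (R : realType) (h : R) : 0 < `|h| < 1 ->
  exists n, (1 / 3) ^+ n.+1 <= `|h| <= (1 / 3) ^+ n.
Proof.
move=> /andP[h0 h1].
have ex : exists n, (1 / 3) ^+ n.+1 <= `|h|.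
  have q1 : `|1 / 3 : R| < 1 by rewrite ger0_norm; lra.
  have /cvgrPdist_lt/(_ _ h0)[N _ /(_ N (leqnn N))] := cvg_expr q1.
  rewrite /= sub0r normrN normrX ger0_norm; last lra.
  move=> hN; exists N; apply: le_trans (ltW hN).
  by rewrite exprS ler_piMl ?exprn_ge0 //; lra.
case: (ex_minnP ex) => n hn min; exists n; rewrite hn /=.
case: n hn min => [|n] hn min; first by rewrite expr0 ltW.
by rewrite leNgt; apply/negP => /ltW/min; rewrite ltnn.
Qed.

(** If [q] stays within a bounded distance of the step function that equals
    [c * d n] on the shell of radius about [3 ^ - n], then [q] and [d] diverge
    together. The constraint [0 <= x + h <= 1] leaves an admissible [h] of each
    size [3 ^ - n] with [n > 0], on one side of [x] at least. *)
Lemma shell_quotient_pinfty (R : realType) (x c C : R) (q : R -> R)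
    (d : nat -> R) :
  0 < c -> 0 <= x <= 1 ->
  (forall n h, 0 <= x + h <= 1 -> (1 / 3) ^+ n.+1 <= `|h| <= (1 / 3) ^+ n ->
    `|q h - c * d n| <= C) ->
  q h @[h --> within [set h : R | 0 <= x + h <= 1] (0 : R)^'] --> +oo <->
  d n @[n --> \oo] --> +oo.
Proof.
move=> c0 x01 qd; have q3 : `|1 / 3 : R| < 1 by rewrite ger0_norm; lra.
split=> /cvgryPge lim; apply/cvgryPge => A.
  have := lim (c * A + C); rewrite near_withinE.
  move=> /nbhs_ballP[r /= r0 qr].
  have /cvgrPdist_lt/(_ _ r0)[N _ small] := cvg_expr q3.
  exists N.+1 => // n /= Nn.
  have pow_gt0 : 0 < (1 / 3) ^+ n :> R by rewrite exprn_gt0 //; lra.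
  have pow_le : (1 / 3) ^+ n <= 1 / 3 :> R.
    case: n Nn {pow_gt0} => // n _.
    by rewrite exprS ler_piMr ?exprn_ile1 //; lra.
  have [h hE xh] : exists2 h : R, `|h| = (1 / 3) ^+ n & 0 <= x + h <= 1.
    have [xl|xr] := leP x (1 / 2).
      by exists ((1 / 3) ^+ n); [rewrite gtr0_norm | lra].
    by exists (- (1 / 3) ^+ n); [rewrite normrN gtr0_norm | lra].
  have h0 : h != 0 by rewrite -normr_gt0 hE.
  have : c * A + C <= q h.
    apply: qr => //; have := small n (ltnW Nn).
    by rewrite /ball /= !sub0r !normrN hE gtr0_norm.
  have hn : (1 / 3) ^+ n.+1 <= `|h| <= (1 / 3) ^+ n.
    by rewrite hE lexx andbT exprS ler_piMl ?(ltW pow_gt0) //; lra.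
  have := qd n h xh hn; rewrite ler_norml => hq hA.
  by rewrite -(ler_pM2l c0); lra.
have [N _ dN] := lim ((A + C) / c); rewrite near_withinE.
have pow_gt0 : 0 < (1 / 3) ^+ N :> R by rewrite exprn_gt0 //; lra.
apply/nbhs_ballP; exists ((1 / 3) ^+ N) => // h; rewrite /ball /= sub0r normrN.
move=> hN h0 xh.
(* points of the ball of radius [3 ^ - N] lie in shells of index at least [N] *)
have [|n hn] := triadic_shell _ h.
  by rewrite normr_gt0 h0 (lt_le_trans hN) // exprn_ile1; lra.
have Nn : (N <= n)%N.
  rewrite leqNgt; apply/negP => nN; case/andP: hn => hn _.
  have := le_lt_trans hn hN.
  by rewrite ltNge => /negP; apply; apply: ler_wiXn2l => //; lra.
have := dN n Nn; rewrite /= ler_pdivrMr // => hd.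
by have := qd n h xh hn; rewrite ler_norml; lra.
Qed.

Theorem theorem1p1 (R : realType) (x : R) (e : nat -> 'I_3) :
  0 <= x <= 1 ->
  ternary_expansion x e ->
  (quotient_tends_to (@okamoto_K R) x +oo <->
     (n%:R - 3 * (count_ones e n)%:R : R) @[n --> \oo] --> +oo) /\
  (quotient_tends_to (@okamoto_K R) x -oo <->
     (n%:R - 3 * (count_ones e n)%:R : R) @[n --> \oo] --> -oo).
Proof.
move=> x01 [xe _ _].
set q := fun h => (okamoto_K (x + h) - okamoto_K x) / h.
set d := fun n => n%:R - 3 * (count_ones e n)%:R : R.
have qd n h : 0 <= x + h <= 1 -> (1 / 3) ^+ n.+1 <= `|h| <= (1 / 3) ^+ n ->
    `|q h - 3 * d n| <= 18.
  move=> /andP[xh _] hn; rewrite -triadic_slope_prefix.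
  have /andP[x0 _] := x01.
  exact: okamoto_K_quotient x0 xh (ternary_prefix_bounds _ _ _ n xe) hn.
have c0 : 0 < 3 :> R by [].
split; first exact: shell_quotient_pinfty c0 x01 qd.
(* the estimate is invariant under negating both [q] and [d] *)
rewrite /quotient_tends_to -/q -!cvgNry.
apply: (shell_quotient_pinfty _ _ _ 18 (- q) (- d) c0 x01) => n h xh hn.
by rewrite mulrN -opprD normrN; exact: qd.
Qed.
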